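(* Let $G=(V,E)$ be a finite simple graph with $n$ vertices. Then the following are equivalent: (i) there exist an ordering $v_1,\dots,v_n$ of $V$ and a real $n\times n$ matrix $M$ of rank one such that $L(G)+M$ is triangular, where $L(G)$ is the Laplacian matrix of $G$ with rows and columns indexed by $v_1,\dots,v_n$; (ii) $G$ is special $2$-threshold.
   Context: Graphs are finite, without loops or parallel edges. For $v\in V$, $N(v)$ is the set of vertices adjacent to $v$, $\deg(v)=|N(v)|$, and for $W\subseteq V$, $N_W(v)=N(v)\cap W$; $G[W]$ denotes the induced subgraph on $W$. The Laplacian matrix $L(G)$ with respect to an ordering $v_1,\dots,v_n$ of $V$ is the $n\times n$ matrix with $L(i,i)=\deg(v_i)$, $L(i,j)=-1$ if $\{v_i,v_j\}\in E$, and $L(i,j)=0$ otherwise. A matrix is triangular if it is upper or lower triangular. For $U\subseteq V$, $G$ is called $U$-threshold if for every nonempty $W\subseteq V$ the induced subgraph $G[W]$ contains a vertex $v$ with $N_W(v)=\emptyset$ or $N_W(v)=(W\setminus\{v\})\cap U$. $G$ is special $2$-threshold if it is $U$-threshold for some $U\subseteq V$. *)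

(* Defs.v *)
From HB Require Import structures.
From mathcomp Require Import all_boot all_order all_algebra.
From mathcomp Require Import reals.

Set Implicit Arguments.
Unset Strict Implicit.
Unset Printing Implicit Defensive.

Import Order.TTheory GRing.Theory Num.Theory.
Local Open Scope ring_scope.

(* A simple graph on a finite vertex type V is given by its adjacency
   relation e; symmetry and irreflexivity of e are left to the theorems. *)

Definition neighbors (V : finType) (e : rel V) (v : V) : {set V} :=
  [set w | e v w].

Definition degree (V : finType) (e : rel V) (v : V) : nat :=
  #|neighbors e v|.

Definition neighbors_in (V : finType) (e : rel V) (W : {set V}) (v : V)
  : {set V} := neighbors e v :&: W.

Definition laplacian (R : pzRingType) (V : finType) (e : rel V) (n : nat)
    (v : 'I_n -> V) : 'M[R]_n :=
  \matrix_(i, j)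
    if i == j then (degree e (v i))%:R
    else if e (v i) (v j) then - 1 else 0.

(* [is_trig_mx] is lower triangularity. *)
Definition triangular (R : pzRingType) (n : nat) (A : 'M[R]_n) : bool :=
  is_trig_mx A || is_trig_mx A^T.

Definition U_threshold (V : finType) (e : rel V) (U : {set V}) : Prop :=
  forall W : {set V}, W != set0 ->
    exists2 v : V, v \in W &
      neighbors_in e W v = set0 \/ neighbors_in e W v = (W :\ v) :&: U.

Definition special_2_threshold (V : finType) (e : rel V) : Prop :=
  exists U : {set V}, U_threshold e U.

(* Main.v *)
Require Import Defs.
From mathcomp Require Import all_boot all_order all_algebra.
From mathcomp Require Import reals.

(** Writing M = x y^T, triangularity of L(G) + M says exactly that the
    adjacency of v_i and v_j is x_i y_j for all i < j: neither the diagonal of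
    L(G) nor the half of M on and beyond the diagonal matters.  Given such x
    and y, take U to be the support of y; the first vertex of W in the ordering
    then has in W either no neighbour (x_i = 0) or exactly those in U.
    Conversely, peeling off the vertices provided by the U-threshold property
    yields the ordering, with x_i in {0, 1} and y the indicator of U; the unused
    entries x_n and y_1 may be set to 1 so that M is nonzero. *)

Set Implicit Arguments.
Unset Strict Implicit.
Unset Printing Implicit Defensive.

Import Order.TTheory GRing.Theory Num.Theory.
Local Open Scope ring_scope.

Lemma mxrank_eq1P (F : fieldType) (m n : nat) (M : 'M[F]_(m, n)) :
  \rank M = 1%N <->
  M != 0 /\ exists (x : 'cV[F]_m) (y : 'rV[F]_n), M = x *m y.
Proof.
split=> [rkM | [nzM [x [y defM]]]].
  split; first by rewrite -mxrank_eq0 rkM.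
  (* The types of both factors mention [\rank M], so they are generalized before the rank is
     rewritten to 1. *)
  have := mulmx_base M; move: (col_base M) (row_base M).
  by rewrite rkM => x y <-; exists x, y.
apply/eqP; rewrite eqn_leq lt0n mxrank_eq0 nzM andbT defM.
exact: mulmx_max_rank.
Qed.

Lemma trmx_laplacian (R : pzRingType) (V : finType) (e : rel V) (n : nat)
    (v : 'I_n -> V) :
  symmetric e -> (laplacian R e v)^T = laplacian R e v.
Proof.
move=> e_sym; apply/matrixP=> i j; rewrite !mxE eq_sym e_sym.
by case: eqVneq => [->|].
Qed.

Lemma trig_laplacian_addP (R : pzRingType) (V : finType) (e : rel V) (n : nat)
    (v : 'I_n -> V) (M : 'M[R]_n) :
  is_trig_mx (laplacian R e v + M) <->
  forall i j : 'I_n, (i < j)%N -> M i j = (e (v i) (v j))%:R.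
Proof.
have LE (i j : 'I_n) : (i < j)%N ->
    (laplacian R e v + M) i j = M i j - (e (v i) (v j))%:R.
  move=> ltij; rewrite !mxE -val_eqE /= ltn_eqF // addrC.
  by case: (e _ _); rewrite ?subr0 ?addr0.
split=> [/is_trig_mxP tr i j ltij | ME].
  by apply/eqP; rewrite -subr_eq0 -LE // tr.
by apply/is_trig_mxP => i j ltij; rewrite LE // ME // subrr.
Qed.

Lemma factored_ordering_U_threshold (F : fieldType) (V : finType) (e : rel V)
    (n : nat) (v : 'I_n -> V) (x : 'cV[F]_n) (y : 'rV[F]_n) :
  irreflexive e -> bijective v ->
  (forall i j : 'I_n, (i < j)%N -> (x *m y) i j = (e (v i) (v j))%:R) ->
  special_2_threshold e.
Proof.
move=> e_irr [w vK wK] xyE.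
exists [set u | y 0 (w u) != 0] => W /set0Pn[u0 Wu0].
have Wi0 : v (w u0) \in W by rewrite wK.
case: (@arg_minnP _ (w u0) (fun i => v i \in W) (@nat_of_ord n) Wi0).
move=> i Wi min_i; exists (v i) => //.
(* By minimality of [i], every other vertex of [W] comes later in the ordering, so the hypothesis on
   [x *m y] applies; a 0/1 entry is nonzero exactly at an edge. *)
have adjE u : u \in W -> u != v i -> e (v i) u = (x i 0 * y 0 (w u) != 0).
  move=> Wu neq_u.
  have /min_i : v (w u) \in W by rewrite wK.
  rewrite leq_eqVlt => /orP[/eqP/val_inj iE | lti].
    by rewrite iE wK eqxx in neq_u.
  have := xyE i (w u) lti; rewrite mxE big_ord1 wK => ->.
  by case: (e _ _); rewrite ?oner_eq0 ?eqxx.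
have [x0|nzx] := eqVneq (x i 0) 0; [left | right]; apply/setP=> u.
  rewrite !inE; have [Wu|_] := boolP (u \in W); last by rewrite andbF.
  have [->|neq_u] := eqVneq u (v i); first by rewrite e_irr.
  by rewrite adjE // x0 mul0r eqxx.
rewrite !inE; have [Wu|_] := boolP (u \in W); last by rewrite !andbF.
have [->|neq_u] := eqVneq u (v i); first by rewrite e_irr.
by rewrite adjE // mulf_eq0 negb_or nzx /= andbT.
Qed.

(** Induction on the size of [W]: the vertex supplied by the threshold property goes in front of an
    ordering of the rest, and [x] records which of the two alternatives it satisfies. *)
Lemma U_threshold_elimination (V : finType) (e : rel V) (U W : {set V}) :
  U_threshold e U ->
  exists (s : seq V) (x : V -> bool),
    [/\ uniq s, s =i W & pairwise (fun a b => e a b == x a && (b \in U)) s].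
Proof.
move=> thrU; have [k] := ubnP #|W|; elim: k W => // k IHk W ltWk.
have [->|nzW] := eqVneq W set0.
  by exists [::], xpred0; split=> // u; rewrite !inE.
have [a Wa Na] := thrU W nzW.
have [|s [x [uniq_s sE pair_s]]] := IHk (W :\ a).
  by rewrite (cardsD1 a) Wa in ltWk.
have nas : a \notin s by rewrite sE !inE eqxx.
have [b bE] : exists b : bool, {in s, forall u, e a u = b && (u \in U)}.
  case: Na => /setP Na; [exists false | exists true] => u; rewrite sE => Du;
    have := Na u; have := Du; rewrite !inE => /andP[nua Wu];
    by rewrite ?nua Wu ?andbT.
exists (a :: s), (fun u => if u == a then b else x u); split.
- by rewrite /= nas.
- by move=> u; rewrite inE sE !inE; case: eqVneq => [->|].
rewrite /= eqxx; apply/andP; split.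
  by apply/allP=> u su; rewrite bE.
(* Redefining [x] at [a] leaves the pairs from [s] unaffected, since [a] is not in [s]. *)
apply: etrans pair_s; apply: eq_in_pairwise (allss s) => c d sc _ /=.
by case: (eqVneq c a) => // ca; rewrite -ca sc in nas.
Qed.

Theorem theorem3p1 (R : realType) (V : finType) (e : rel V) (n : nat)
    (e_sym : symmetric e) (e_irr : irreflexive e)
    (card_V : #|V| = n) (n_gt0 : (0 < n)%N) :
  (exists (v : 'I_n -> V) (M : 'M[R]_n),
     [/\ bijective v, \rank M = 1%N & triangular (laplacian R e v + M)])
  <-> special_2_threshold e.
Proof.
split=> [[v [M [bij_v rkM triM]]] | [U thrU]].
  (* The upper triangular case follows by transposing: the Laplacian is symmetric and [M^T] has the
     same rank. *)
  wlog trigM : M rkM {triM} / is_trig_mx (laplacian R e v + M).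
    move=> lower; case/orP: triM; first exact: lower.
    by rewrite linearD /= trmx_laplacian //; apply: lower; rewrite mxrank_tr.
  have [_ [x [y defM]]] := (mxrank_eq1P M).1 rkM.
  move/trig_laplacian_addP: trigM; rewrite defM.
  exact: factored_ordering_U_threshold.
have [s [x [uniq_s sE /(pairwiseP _) pair_s]]] :=
  U_threshold_elimination [set: V] thrU.
case: n n_gt0 card_V => // n _ card_V.
have size_s : size s = n.+1.
  by rewrite -card_V -(card_uniqP uniq_s); apply: eq_card => u; rewrite sE !inE.
have a0 : V by case: s size_s {uniq_s sE pair_s}.
pose v (i : 'I_n.+1) := nth a0 s i.
pose xv := \col_i (x (v i) || (i == ord_max))%:R : 'cV[R]_n.+1.
pose yv := \row_j ((v j \in U) || (j == ord0))%:R : 'rV[R]_n.+1.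
exists v, (xv *m yv); split.
- apply: inj_card_bij; last by rewrite card_V card_ord.
  move=> i j /eqP; rewrite nth_uniq ?size_s ?ltn_ord // => /eqP.
  exact: val_inj.
- apply/mxrank_eq1P; split; last by exists xv, yv.
  (* The corner entry in the last row and first column is 1 by the choice of [xv] and [yv]. *)
  apply/eqP => /matrixP/(_ ord_max ord0)/eqP.
  by rewrite !mxE big_ord1 !mxE !eqxx !orbT mulr1 oner_eq0.
apply/orP; left; apply/trig_laplacian_addP => i j ltij.
have -> : e (v i) (v j) = x (v i) && (v j \in U).
  by apply/eqP/pair_s; rewrite ?inE ?size_s ?ltn_ord.
(* As [i < j], row [i] is not the last and column [j] is not the first, so the entries forced to 1
   do not interfere. *)
have ltin : (i < n)%N by rewrite (leq_trans ltij) // -ltnS.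
have jgt0 : (0 < j)%N by rewrite (leq_trans _ ltij).
rewrite mxE big_ord1 !mxE -!val_eqE /= (ltn_eqF ltin) (gtn_eqF jgt0) !orbF.
by rewrite -natrM mulnb.
Qed.
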